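(* Let $\lambda_1,\lambda_2>0$, let $\mu$ be a probability distribution on $(0,\infty)$, let $\nu$ be a probability distribution on $\mathbb R$, and let $h:\mathbb R\to\mathbb R$ be bounded and increasing. Suppose there exist $a,b$ in the support of $\nu$ with $b-a>\sup h-\inf h$. Then the log income process $(X_t)_{t\ge0}$ determined by $(\lambda_1,\lambda_2,\mu,\nu,h)$, with transition probability function $(P_t)_{t\ge0}$, is globally stable: there exists a unique stationary distribution $\phi^*$ on $\mathbb R$ and $$\lim_{t\to\infty}\beta(\phi P_t,\phi^* )=0\quad\text{for all }\phi\in\mathcal P(\mathbb R).$$
   Context: Log income process. Put $\lambda=\lambda_1+\lambda_2$, $q=\lambda_1/\lambda$, $p=\lambda_2/\lambda$. Let $(N_t)_{t\ge0}$ be a Poisson process with rate $\lambda$ and $X_t=Z_{N_t}$, where $Z_0=X_0$ and the embedded chain is $$Z_{n+1}=\begin{cases}Z_n+\eta_{n+1}&\text{with probability }q\ \text{(income shock)},\\ h(Z_n)+\zeta_{n+1}&\text{with probability }p\ \text{(reset)}.\end{cases}$$ Here $(\eta_n)$ and $(\zeta_n)$ are iid from $\mu$ and $\nu$ respectively; these sequences, the iid shock-type choices, the Poisson process and $X_0$ are independent. The transition probability function is $P_t(x,B)=\mathbb P\{X_t\in B\mid X_0=x\}$, and $(\phi P_t)(B)=\int P_t(x,B)\phi(dx)$. A stationary distribution is a $\phi^*\in\mathcal P(\mathbb R)$ with $\phi^*P_t=\phi^*$ for all $t\ge0$. $\mathcal P(\mathbb R)$ is the set of Borel probability measures on $\mathbb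 R$, and $\beta(\phi,\psi)=\sup|\int g\,d\phi-\int g\,d\psi|$ with the supremum over increasing (nondecreasing) functions $g:\mathbb R\to\mathbb R$ with $|g|\le1$. ''Increasing'' means nondecreasing throughout. *)

(* Defs.v *)
From HB Require Import structures.
From mathcomp Require Import all_boot all_order all_algebra.
From mathcomp Require Import all_classical all_reals all_analysis.
From mathcomp Require Import measurable_realfun.

Set Implicit Arguments.
Unset Strict Implicit.
Unset Printing Implicit Defensive.

Import Order.TTheory GRing.Theory Num.Theory.
Import numFieldNormedType.Exports.

Local Open Scope classical_set_scope.
Local Open Scope ring_scope.

Section Independence.
Context d (W : measurableType d) (R : realType) (P : probability W R).

Definition mutually_independent (I : eqType) (F : I -> set_system W) : Prop :=
  forall (J : seq I) (A : I -> set W), uniq J ->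
    (forall i, i \in J -> F i (A i)) ->
    P (\bigcap_(i in [set` J]) A i) = (\prod_(i <- J) P (A i))%E.

Definition sigma_of d' (T : measurableType d') (X : W -> T) : set_system W :=
  preimage_set_system setT X measurable.

Definition sigma_of_family d' (T : measurableType d') (I : Type) (D : set I)
    (X : I -> W -> T) : set_system W :=
  <<s \bigcup_(i in D) sigma_of (X i) >>.

Definition iid d' (T : measurableType d') (X : nat -> {RV P >-> T})
    (mu : probability T R) : Prop :=
  mutually_independent (fun n => sigma_of (X n)) /\
  forall n B, measurable B -> distribution P (X n) B = mu B.

End Independence.

(* The time index ranges over all of R, but only times t >= 0 are constrained.
   The increments are natural numbers, since paths are almost surely
   nondecreasing. *)
Record poisson_process d (W : measurableType d) (R : realType)
    (P : probability W R) (rate : R) (N : R -> {RV P >-> nat}) : Prop := {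
  poisson_paths : {ae P, forall w,
    [/\ N 0 w = 0%N,
        (forall s t, 0 <= s -> s <= t -> (N s w <= N t w)%N) &
        (forall t, 0 <= t -> \forall s \near t^'+, N s w = N t w)]};
  poisson_increments : forall s t k, 0 <= s -> s < t ->
    P [set w | (N t w - N s w)%N = k] = (poisson_pmf (rate * (t - s)) k)%:E;
  poisson_independent : forall tau : nat -> R,
    0 <= tau 0%N -> nondecreasing_seq tau ->
    mutually_independent P
      (fun k => sigma_of (fun w => (N (tau k.+1) w - N (tau k) w)%N)) }.

(* [shock n w] selects the branch taken at step [n.+1]: [true] is an income
   shock.  All three driving sequences are shifted by one, so [eta n], [zeta n]
   and [shock n] produce Z_{n+1} from Z_n. *)
Fixpoint embedded_chain (R : realType) (W : Type) (h : R -> R)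
    (shock : nat -> W -> bool) (eta zeta : nat -> W -> R) (Z0 : W -> R)
    (n : nat) (w : W) : R :=
  if n is m.+1 then
    let z := embedded_chain h shock eta zeta Z0 m w in
    if shock m w then z + eta m w else h z + zeta m w
  else Z0 w.

Definition log_income (R : realType) (W : Type) (h : R -> R)
    (N : R -> W -> nat) (shock : nat -> W -> bool) (eta zeta : nat -> W -> R)
    (X0 : W -> R) (t : R) (w : W) : R :=
  embedded_chain h shock eta zeta X0 (N t w) w.

Record log_income_driver d (W : measurableType d) (R : realType)
    (P : probability W R) (lambda1 lambda2 : R) (mu nu : probability R R)
    (N : R -> {RV P >-> nat}) (shock : nat -> {RV P >-> bool})
    (eta zeta : nat -> {RV P >-> R}) : Prop := {
  driver_clock : poisson_process (lambda1 + lambda2) N;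
  driver_shock : iid shock (bernoulli_prob (lambda1 / (lambda1 + lambda2)));
  driver_eta : iid eta mu;
  driver_zeta : iid zeta nu;
  driver_indep : mutually_independent P (fun i : 'I_4 => nth set0
    [:: sigma_of_family [set t | 0 <= t] N; sigma_of_family setT shock;
        sigma_of_family setT eta; sigma_of_family setT zeta] i) }.

Section Transition.
Context d (W : measurableType d) (R : realType) (P : probability W R).
Context (h : R -> R) (h_nd : nondecreasing_fun h).
Context (N : R -> {RV P >-> nat}) (shock : nat -> {RV P >-> bool}).
Context (eta zeta : nat -> {RV P >-> R}).

Let chain (n : nat) (u : R * W) : R :=
  embedded_chain h shock eta zeta (cst u.1) n u.2.

Lemma measurable_chain n : measurable_fun setT (chain n).
Proof.
elim: n => [|n IH]; first exact: measurable_fst.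
apply: (@measurable_fun_ifT _ _ _ _
    (fun u => chain n u + eta n u.2) (fun u => h (chain n u) + zeta n u.2)
    (fun u => shock n u.2)).
- by apply: measurableT_comp => //; exact: measurable_snd.
- apply: measurable_funD => //.
  by apply: measurableT_comp => //; exact: measurable_snd.
- apply: measurable_funD.
    by apply: measurableT_comp => //; exact: nondecreasing_measurable.
  by apply: measurableT_comp => //; exact: measurable_snd.
Qed.

Lemma measurable_log_income t :
  measurable_fun [set: R * W]
    (fun u => log_income h N shock eta zeta (cst u.1) t u.2).
Proof.
move=> _ B mB; rewrite setTI.
rewrite (_ : _ @^-1` B = \bigcup_n
    ((fun u : R * W => N t u.2) @^-1` [set n] `&` chain n @^-1` B)); last first.
  apply/seteqP; split => [u Bu|u [n _ [/= Nn]]]; first by exists (N t u.2).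
  by rewrite /log_income Nn.
apply: bigcupT_measurable => n; apply: measurableI.
- rewrite -[X in measurable X]setTI.
  have : measurable_fun [set: R * W] (fun u : R * W => N t u.2).
    by apply: measurableT_comp => //; exact: measurable_snd.
  exact.
- by rewrite -[X in measurable X]setTI; exact: measurable_chain.
Qed.

Lemma measurable_log_income_at t x :
  measurable_fun [set: W] (log_income h N shock eta zeta (cst x) t).
Proof.
exact: (measurableT_comp (measurable_log_income t) (pair1_measurable x)).
Qed.

Definition log_income_from (t x : R) : {RV P >-> R} := HB.pack_for
  {mfun W >-> R} (log_income h N shock eta zeta (cst x) t)
  (isMeasurableFun.Build _ _ _ _ _ (measurable_log_income_at t x)).

(* P_t(x, B) = P{X_t \in B | X_0 = x}: since X_0 is independent of the driving
   variables, conditioning on X_0 = x starts the recursion at the constant x. *)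
Definition transition (t x : R) : {measure set R -> \bar R} :=
  distribution P (log_income_from t x).

Lemma measurable_transition t (B : set R) : measurable B ->
  measurable_fun [set: R] (transition t ^~ B).
Proof.
move=> mB.
have mX : measurable ((fun u : R * W =>
    log_income h N shock eta zeta (cst u.1) t u.2) @^-1` B).
  by rewrite -[X in measurable X]setTI; exact: measurable_log_income.
apply: eq_measurable_fun (measurable_fun_xsection P mX) => x _ /=.
by congr (P _); apply/seteqP; split => w; rewrite /xsection/= inE.
Qed.

HB.instance Definition _ t := isKernel.Build _ _ _ _ _
  (transition t) (measurable_transition t).

Lemma transition_setT t x : transition t x [set: R] = 1%E.
Proof. exact: probability_setT. Qed.

HB.instance Definition _ t := Kernel_isProbability.Build _ _ _ _ _
  (transition t) (transition_setT t).

End Transition.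

Section Evolve.
Local Open Scope ereal_scope.
Context (R : realType) (phi : probability R R) (k : R.-pker R ~> R).

Definition evolve (B : set R) : \bar R := \int[phi]_x k x B.

Let evolve0 : evolve set0 = 0.
Proof. by rewrite /evolve integral0_eq// => x _; rewrite measure0. Qed.

Let evolve_ge0 B : 0 <= evolve B. Proof. exact: integral_ge0. Qed.

Let evolve_sigma_additive : semi_sigma_additive evolve.
Proof.
move=> U mU tU mUU; rewrite [X in _ --> X](_ : _ =
  \int[phi]_x (\sum_(n <oo) k x (U n))); last first.
  apply: eq_integral => V _.
  by apply/esym/cvg_lim => //; exact/measure_semi_sigma_additive.
apply/cvg_closeP; split.
  by apply: is_cvg_nneseries => n _ _; exact: integral_ge0.
rewrite closeE// integral_nneseries// => n.
exact: measurable_kernel.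
Qed.

HB.instance Definition _ := isMeasure.Build _ _ R evolve
  evolve0 evolve_ge0 evolve_sigma_additive.

Let evolve_setT : evolve [set: R] = 1.
Proof.
rewrite /evolve (eq_integral (cst 1)); last by move=> x _; exact: prob_kernel.
by rewrite integral_cst//= mul1e probability_setT.
Qed.

HB.instance Definition _ := Measure_isProbability.Build _ _ R evolve evolve_setT.

End Evolve.

Definition measure_support (R : realType) (nu : probability R R) : set R :=
  [set x | forall U, open_nbhs x U -> (0 < nu U)%E].

Definition beta_dist (R : realType) (phi psi : probability R R) : \bar R :=
  ereal_sup [set `|\int[phi]_x (g x)%:E - \int[psi]_x (g x)%:E|%E
    | g in [set g : R -> R | nondecreasing_fun g /\ forall x, `|g x| <= 1]].

Definition stationary (R : realType) (k : R -> R.-pker R ~> R)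
    (phi : probability R R) : Prop :=
  forall t, 0 <= t -> forall B, measurable B -> evolve phi (k t) B = phi B.

(* Uniqueness is up to equality on Borel sets: a measure is a function on all
   sets, and its values on non-measurable sets carry no information. *)
Definition globally_stable (R : realType) (k : R -> R.-pker R ~> R) : Prop :=
  exists phi' : probability R R,
    [/\ stationary k phi',
        (forall psi, stationary k psi ->
           forall B, measurable B -> psi B = phi' B) &
        (forall phi : probability R R,
           beta_dist (evolve phi (k t)) phi' @[t --> +oo%R] --> 0%E)].

(* Main.v *)
Require Import Defs.
From HB Require Import structures.
From mathcomp Require Import all_boot all_order all_algebra.
From mathcomp Require Import all_classical all_reals all_analysis.
From mathcomp Require Import measurable_realfun interval_inference ring lra.

(** The proof is a Banach fixed point argument for the embedded chain, carried
    over to continuous time by conditioning on the number of jumps.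

    Write Q for the one-step kernel of the embedded chain (shock_kernel) and
    compare two laws phi, psi by the smallest K such that phi U <= psi U + K
    and psi U <= phi U + K for every upper set U of the line; up to a factor 2
    this is the metric beta, because a monotone function is an average of
    indicators of upper sets.  More precisely (tail_le_integral), integrals of
    a monotone function of oscillation at most e differ by at most e * K.

    Q contracts this distance.  For U an upper set, x |-> Q x U is monotone.
    The income branch contributes at most q to its oscillation.  The reset
    branch contributes the nu-mass of an interval of length at most
    sup h - inf h, and since the support of nu contains two points further
    apart than that, this interval misses a fixed neighbourhood of one of them
    (support_overlap): the mass is at most 1 - eps.  Altogether the oscillation
    is at most rho = q + (1 - q) (1 - eps) < 1 (tail_le_shock_kernel).

    The laws of the line are complete for this distance (tail_le_complete): a
    uniform limit of cumulative distribution functions is one, and defines a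
    Lebesgue-Stieltjes probability.  Hence Q has an invariant law
    (invariant_law_exists).

    Independence of the clock, the branch choices and the shocks gives
    phi P_t = sum_n P (N_t = n) phi Q^n (evolve_transition).  So a law invariant
    under Q is stationary, and for a Poisson clock
    the distance between phi P_t and psi P_t is at most
    sum_n P (N_t = n) rho^n = exp (- lambda (1 - rho) t) (tail_le_transition),
    uniformly in phi and psi.  Uniqueness and convergence follow. *)

Set Implicit Arguments.
Unset Strict Implicit.
Unset Printing Implicit Defensive.

Import Order.TTheory GRing.Theory Num.Theory.
Import numFieldNormedType.Exports.

Local Open Scope classical_set_scope.
Local Open Scope ring_scope.

(** * Upper sets and the distance between tails *)

Section UpperSets.
Context (R : realType).
Implicit Types (U : set R) (phi psi : probability R R) (K : R).

Definition up_closed U := forall x y, x <= y -> U x -> U y.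

Lemma up_closed_measurable U : up_closed U -> measurable U.
Proof.
move=> upU; apply: is_interval_measurable => x y Ux _ z /andP[xz _].
exact: upU Ux.
Qed.

Lemma up_closed_ray (y : R) : up_closed `]y, +oo[%classic.
Proof. by move=> u v uv /=; rewrite !in_itv/= !andbT => /lt_le_trans; apply. Qed.

Lemma up_closed_shift U x : up_closed U -> up_closed [set y | U (x + y)].
Proof. by move=> upU y z yz; apply: upU; rewrite lerD2l. Qed.

(** One-sided form of the uniform distance between tail functions: with K = 0
    it is the usual stochastic order.  Keeping the two sides apart avoids
    subtracting extended reals. *)
Definition tail_le K phi psi :=
  forall U, up_closed U -> (phi U <= psi U + K%:E)%E.

Lemma tail_le1 phi psi : tail_le 1 phi psi.
Proof.
move=> U upU; apply: le_trans (probability_le1 _ (up_closed_measurable upU)) _.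
by rewrite leeDr// measure_ge0.
Qed.

Lemma tail_le_trans K L chi phi psi :
  tail_le K phi chi -> tail_le L chi psi -> tail_le (K + L) phi psi.
Proof.
move=> pc cp U upU; apply: le_trans (pc U upU) _.
by rewrite (addrC K) EFinD addeA; apply: leeD2r; exact: cp.
Qed.

Lemma nondecreasing_bounded_integrable phi (g : R -> R) (a b : R) :
  nondecreasing_fun g -> (forall x, a <= g x <= b) ->
  phi.-integrable setT (EFin \o g).
Proof.
move=> gnd gb; apply: measurable_bounded_integrable => //.
- by apply: le_lt_trans (probability_le1 _ _) _ => //; rewrite ltry.
- exact: nondecreasing_measurable.
- exists (`|a| + `|b|); split; first by rewrite num_real.
  move=> M abM x _; apply: (le_trans _ (ltW abM)) => /=.
  have /andP[ag gb'] := gb x; rewrite ler_norml.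
  rewrite (le_trans gb') ?andbT; last by rewrite ler_wpDl ?ler_norm.
  rewrite lerNl (le_trans (_ : _ <= `|a|)) ?lerDl//.
  by rewrite -normrN (le_trans _ (ler_norm _))// lerN2.
Qed.

(** By the layer-cake formula the integral of g - c is the integral over levels
    r of the mass of the upper set where g - c > r.  Only the levels below e
    matter, and each of them costs at most K. *)
Lemma tail_le_integral K phi psi (g : R -> R) (c e : R) :
  0 <= K -> 0 <= e -> tail_le K phi psi ->
  nondecreasing_fun g -> (forall x, c <= g x <= c + e) ->
  (\int[phi]_x (g x)%:E <= \int[psi]_x (g x)%:E + (e * K)%:E)%E.
Proof.
move=> K0 e0 Kpp gnd gb.
have mg : measurable_fun setT (fun x => g x - c).
  by apply: measurable_funB => //; exact: nondecreasing_measurable.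
pose X : {mfun R >-> R} := mfun_Sub (mem_set mg).
have X0 x : 0 <= X x by rewrite subr_ge0; case/andP: (gb x).
have intE (chi : probability R R) :
    (\int[chi]_x (g x)%:E = 'E_chi[X] + c%:E)%E.
  rewrite expectation_def; under [in RHS]eq_integral do rewrite EFinB.
  rewrite integralB//.
  - by rewrite integral_cst// [X in (_ * X)%E]probability_setT mule1 subeK.
  - exact: nondecreasing_bounded_integrable gb.
  - exact: finite_measure_integrable_cst.
(* The error term K is itself written as an integral over the levels [0, e[. *)
rewrite !intE addeAC; apply: leeD2r.
rewrite (@ge0_expectation_ccdf _ _ _ phi X)//.
rewrite (@ge0_expectation_ccdf _ _ _ psi X)//.
set D := [set` `[0, +oo[%R].
have mD : measurable D by exact: measurable_itv.
have -> : (e * K)%:E = (\int[lebesgue_measure]_(r in D)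
    (K%:E * (\1_(`[0%R, e[ : set R) r)%:E))%E.
  rewrite ge0_integralZl//=.
  - rewrite integral_indic//; rewrite (_ : _ `&` _ = `[0, e[%classic); last first.
      by rewrite setIidl//; exact: subset_itvl.
    rewrite [X in _ = (_ * X)%E]lebesgue_measure_itv/= lte_fin.
    case: ltgtP e0 => // [_ _|<- _]; first by rewrite sube0 -EFinM mulrC.
    by rewrite mul0r mule0.
  - exact/measurable_EFinP/measurable_indic.
have mccdf (chi : probability R R) :
    measurable_fun D (ccdf (X : {RV chi >-> R})).
  by apply: measurable_funTS; exact: ccdf_measurable.
rewrite -ge0_integralD//; last 3 first.
- exact: mccdf.
- by move=> r _; rewrite -EFinM lee_fin mulr_ge0.
- by apply/measurable_EFinP/measurable_funM => //; exact: measurable_indic.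
apply: ge0_le_integral => //.
- exact: mccdf.
- apply: emeasurable_funD; first exact: mccdf.
  by apply/measurable_EFinP/measurable_funM => //; exact: measurable_indic.
move=> r; rewrite /D /= in_itv/= andbT => r0.
rewrite /ccdf /distribution /pushforward.
have [re|er] := ltP r e.
- rewrite indicE mem_set/= ?in_itv/= ?r0// mule1; apply: Kpp => x y xy/=.
  rewrite !in_itv/= !andbT => /lt_le_trans; apply.
  by rewrite lerD2r; exact: gnd.
- rewrite (_ : _ @^-1` _ = set0) ?measure0 ?adde_ge0//.
    by rewrite -EFinM lee_fin mulr_ge0.
  apply/seteqP; split=> // x /=; rewrite in_itv/= andbT => /(le_lt_trans er).
  by rewrite ltNge lerBlDl; case/andP: (gb x) => _ ->.
Qed.

End UpperSets.

Lemma beta_dist_le (R : realType) (K : R) (phi psi : probability R R) : 0 <= K ->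
  tail_le K phi psi -> tail_le K psi phi ->
  (0 <= beta_dist phi psi <= (2 * K)%:E)%E.
Proof.
move=> K0 pq qp; apply/andP; split.
  apply: (@le_trans _ _ `|\int[phi]_x (cst 0 x)%:E - \int[psi]_x (cst 0 x)%:E|%E).
    exact: abse_ge0.
  apply: ereal_sup_ubound; exists (cst 0) => //; split.
    by move=> x y _; exact: lexx.
  by move=> x; rewrite /= normr0.
apply: ge_ereal_sup => _ [g [gnd g1] <-].
have gb x : -1 <= g x <= 1 by rewrite -ler_norml.
have gb2 x : -1 <= g x <= -1 + 2 by rewrite (_ : -1 + 2 = 1)//; ring.
have int (chi : probability R R) : (\int[chi]_x (g x)%:E)%E \is a fin_num.
  by apply: integrable_fin_num => //; exact: nondecreasing_bounded_integrable gb.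
have := tail_le_integral K0 (ler0n _ 2) pq gnd gb2.
have := tail_le_integral K0 (ler0n _ 2) qp gnd gb2.
rewrite -(fineK (int phi)) -(fineK (int psi)) -!EFinD !lee_fin => ? ?.
by rewrite ler_norml; apply/andP; split; lra.
Qed.

(** * Completeness *)

Section Completeness.
Context (R : realType).
Implicit Types (phi psi : probability R R) (K : R).

(** An upper set other than set0 and setT is an open or a closed ray, and a
    closed ray is a decreasing intersection of open ones. *)
Lemma tail_le_open_rays K phi psi : 0 <= K ->
  (forall y, (phi `]y, +oo[%classic <= psi `]y, +oo[%classic + K%:E)%E) ->
  tail_le K phi psi.
Proof.
move=> K0 rays U upU; have mU := up_closed_measurable upU.
have [->|/set0P[x1 Ux1]] := eqVneq U set0.
  by rewrite !measure0 add0e lee_fin.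
have [->|] := eqVneq U setT.
  rewrite [leLHS]probability_setT [X in (X + _)%E]probability_setT.
  by rewrite leeDl// lee_fin.
move=> /setTPn[x0 nUx0].
have lbU x : ~ U x -> lbound U x.
  by move=> nUx z Uz; rewrite leNgt; apply/negP => /ltW/upU/(_ Uz).
have infU : has_inf U by split; [exists x1|exists x0; exact: lbU].
pose y := inf U.
have Uy z : y < z -> U z.
  by move=> /(inf_lt (ex_intro _ x1 Ux1))[w Uw wz]; exact: upU (ltW wz) Uw.
have yU z : U z -> y <= z by move=> Uz; apply: ge_inf => //; case: infU.
have [Uyy|nUyy] := pselect (U y); last first.
  suff -> : U = `]y, +oo[%classic by exact: rays.
  apply/seteqP; split => z /=; rewrite in_itv/= andbT; last exact: Uy.
  move=> Uz; rewrite lt_neqAle yU// andbT; apply/eqP => yz.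
  by apply: nUyy; rewrite yz.
pose V (n : nat) := `]y - n.+1%:R^-1, +oo[%classic.
have UV n : U `<=` V n.
  move=> z /yU yz; rewrite /V/= in_itv/= andbT.
  by rewrite (lt_le_trans _ yz)// ltrBlDr ltrDl invr_gt0.
have mV n : measurable (V n) by exact: measurable_itv.
have -> : psi U = lim (psi (V n) @[n --> \oo]).
  have -> : U = \bigcap_n V n.
    rewrite -itvcyEbigcap; apply/seteqP; split => z /=; rewrite in_itv/= andbT.
      exact: yU.
    by move=> yz; exact: upU yz Uyy.
  apply/esym/cvg_lim => //; apply: nonincreasing_cvg_mu => //.
  - by apply: le_lt_trans (probability_le1 _ _) _; rewrite ?ltry.
  - by apply: bigcapT_measurable.
  - move=> m n mn; apply/subsetPset => z; rewrite /V/= !in_itv/= !andbT.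
    by apply: le_lt_trans; rewrite lerD2l lerN2 lef_pV2 ?posrE// ler_nat.
rewrite -leeBlDr//; apply: lime_ge.
  apply: ereal_nonincreasing_is_cvgn => m n mn; apply: le_measure.
  - by rewrite inE; exact: measurable_itv.
  - by rewrite inE; exact: measurable_itv.
  - move=> z; rewrite /V/= !in_itv/= !andbT.
    by apply: le_lt_trans; rewrite lerD2l lerN2 lef_pV2 ?posrE// ler_nat.
apply: nearW => n; rewrite leeBlDr//; apply: le_trans (rays _).
by apply: le_measure; rewrite ?inE//; exact: (UV n).
Qed.

Lemma open_rays_eq phi psi :
  (forall y, phi `]y, +oo[%classic = psi `]y, +oo[%classic) ->
  forall B, measurable B -> phi B = psi B.
Proof.
move=> rays B mB.
apply: (measure_unique (@RGenOInfty.G R) (fun n => `](- n%:R), +oo[%classic)) => //.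
- exact: RGenOInfty.measurableE.
- move=> _ _ [x ->] [y ->]; exists (Num.max x y); apply/seteqP; split => z /=;
    rewrite !in_itv/= !andbT gt_max.
    by move=> [-> ->].
  by move=> /andP[].
- by move=> n; exists (- n%:R).
- apply/seteqP; split => // x _; exists (Num.truncn `|x|).+1 => //=.
  rewrite in_itv/= andbT ltrNl (le_lt_trans (ler_norm _))// normrN.
  exact: truncnS_gt.
- by move=> _ [y ->]; exact: rays.
- by move=> n; apply: le_lt_trans (probability_le1 _ _) _; rewrite ?ltry.
Qed.

Lemma tail_le_cvg0_eq (r : nat -> R) phi psi : r n @[n --> \oo] --> 0 ->
  (forall n, tail_le (r n) phi psi /\ tail_le (r n) psi phi) ->
  forall B, measurable B -> phi B = psi B.
Proof.
move=> r0 pp; apply: open_rays_eq => y.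
have le (chi xi : probability R R) : (forall n, tail_le (r n) chi xi) ->
    (chi `]y, +oo[%classic <= xi `]y, +oo[%classic)%E.
  move=> cx; rewrite -(fineK (fin_num_measure chi _ (measurable_itv _))).
  rewrite -(fineK (fin_num_measure xi _ (measurable_itv _))) lee_fin.
  rewrite -[leRHS]addr0.
  have : fine (xi `]y, +oo[%classic) + r n @[n --> \oo] -->
      fine (xi `]y, +oo[%classic) + 0 by apply: cvgD => //; exact: cvg_cst.
  move=> /(@cvg_lim _ (@Rhausdorff R)) <-.
  apply: limr_ge.
    by apply: is_cvgD; [exact: is_cvg_cst|apply/cvg_ex; exists 0].
  apply: nearW => n; rewrite -lee_fin EFinD !fineK ?fin_num_measure//; apply: cx.
  exact: up_closed_ray.
by apply/eqP; rewrite eq_le !le// => n; case: (pp n).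
Qed.

(** Limits commute with uniform limits, along any filter: used for right limits
    and for the limits at both infinities of a distribution function. *)
Lemma cvg_uniform_approx (G : set_system R) {FG : Filter G} (F : R -> R) (l : R)
    (f : nat -> R -> R) (a r : nat -> R) :
  r n @[n --> \oo] --> 0 ->
  (forall n, f n y @[y --> G] --> a n) ->
  (forall n y, `|F y - f n y| <= r n) -> (forall n, `|a n - l| <= r n) ->
  F y @[y --> G] --> l.
Proof.
move=> r0 fa Ff al; apply/cvgrPdist_le => /= e e0.
have e3 : 0 < e / 3 by rewrite divr_gt0.
have /cvgrPdist_le/(_ _ e3)[n _ /(_ n (leqnn n)) /=] := r0.
rewrite sub0r normrN => rn.
have /cvgrPdist_le/(_ _ e3) := fa n; apply: filterS => y fy.
have := le_trans (ler_norm _) rn => rn'.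
have : l - F y = - (a n - l) + (a n - f n y) - (F y - f n y) by ring.
move=> ->; rewrite (_ : e = e / 3 + e / 3 + e / 3); last by field.
apply: le_trans (ler_normB _ _) _; apply: lerD; last exact: le_trans (Ff n y) rn'.
apply: le_trans (ler_normD _ _) _; apply: lerD => //.
by rewrite normrN; exact: le_trans (al n) rn'.
Qed.

(** The distribution functions f n are uniformly Cauchy, so their uniform limit F
    is again nondecreasing, right-continuous and normalised, and the
    Lebesgue-Stieltjes measure of F is the limit law. *)
Lemma tail_le_complete (r : nat -> R) (phi : nat -> probability R R) :
  (forall n, 0 <= r n) -> r n @[n --> \oo] --> 0 ->
  (forall n m, (n <= m)%N ->
     tail_le (r n) (phi n) (phi m) /\ tail_le (r n) (phi m) (phi n)) ->
  exists psi : probability R R,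
    forall n, tail_le (r n) (phi n) psi /\ tail_le (r n) psi (phi n).
Proof.
move=> r_ge0 r0 cauchy.
pose idR : {mfun R >-> R} := mfun_Sub (mem_set (@measurable_id _ R setT)).
pose f n y := fine (cdf (idR : {RV (phi n) >-> R}) y).
have fE n y : ((f n y)%:E = cdf (idR : {RV (phi n) >-> R}) y)%E.
  by rewrite /f fineK// fin_num_measure.
have rayE n y : (phi n `]y, +oo[%classic = (1 - f n y)%:E)%E.
  by rewrite EFinB fE -ccdf_1_cdf /ccdf /distribution /pushforward.
have fcauchy n m y : f n y - r n <= f m y + r m.
  suff H i j z : (i <= j)%N -> `|f i z - f j z| <= r i.
    have [nm|/ltnW mn] := leqP n m.
      have := H _ _ y nm; rewrite ler_norml => /andP[_ h].
      by have := r_ge0 m; lra.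
    have := H _ _ y mn; rewrite ler_norml => /andP[h _].
    by have := r_ge0 n; lra.
  move=> /cauchy[/(_ _ (up_closed_ray (y := z)))+ /(_ _ (up_closed_ray (y := z)))].
  rewrite !rayE -!EFinD !lee_fin ler_norml => ? ?; apply/andP; split; lra.
(* Since f n - r n <= f m + r m for all n and m, this infimum is the limit of
   f n y and lies within r n of it: no limit has to be taken. *)
pose F y := inf [set f n y + r n | n in [set: nat]].
have hasinf y : has_inf [set f n y + r n | n in [set: nat]].
  split; first by exists (f 0 y + r 0); exists 0.
  by exists (f 0 y - r 0) => _ [n _ <-].
have Ff n y : `|F y - f n y| <= r n.
  rewrite ler_distl; apply/andP; split.
    by apply: lb_le_inf; [case: (hasinf y)|move=> _ [m _ <-]].
  by apply: ge_inf; [case: (hasinf y)|exists n].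
have Fnd : nondecreasing F.
  move=> x y xy; apply: lb_le_inf; first by case: (hasinf y).
  move=> _ [n _ <-]; apply: (@le_trans _ _ (f n x + r n)).
    by apply: ge_inf; [case: (hasinf x)|exists n].
  rewrite lerD2r -lee_fin !fE; exact: cdf_nondecreasing.
have Frc : right_continuous F.
  move=> y; apply: (cvg_uniform_approx (f := f) (a := f^~ y) r0) => //.
    by move=> n; apply: fine_cvg; rewrite fE; exact: cdf_right_continuous.
  by move=> n; rewrite distrC.
have FNy : F @ -oo --> (0 : R).
  apply: (cvg_uniform_approx (f := f) (a := cst 0) r0) => //.
    by move=> n; apply: fine_cvg; exact: cvg_cdfNy0.
  by move=> n; rewrite subrr normr0.
have Fy : F @ +oo --> (1 : R).
  apply: (cvg_uniform_approx (f := f) (a := cst 1) r0) => //.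
    by move=> n; apply: fine_cvg; exact: cvg_cdfy1.
  by move=> n; rewrite subrr normr0.
pose FB : cumulativeBounded (0 : R) (1 : R) := HB.pack_for
  (cumulativeBounded (0 : R) (1 : R)) F
  (isCumulative.Build R _ R F Fnd Frc)
  (isCumulativeBounded.Build R 0 1 F FNy Fy).
pose psi0 : probability (measurableTypeR R) R := lebesgue_stieltjes_measure FB.
(* Two measurable structures with the same Borel sets live on R: the identity
   transports the measure from one to the other. *)
have midT : @measurable_fun _ _ (measurableTypeR R) R setT idfun.
  exact: measurable_id.
pose idT : {mfun measurableTypeR R >-> R} := HB.pack_for
  {mfun measurableTypeR R >-> R} (idfun : measurableTypeR R -> R)
  (isMeasurableFun.Build _ _ (measurableTypeR R) R idfun midT).
pose psi : probability R R := distribution psi0 idT.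
have psiE y : (psi `]y, +oo[%classic = (1 - F y)%:E)%E.
  rewrite EFinB -(cdf_lebesgue_stieltjes_id FB y).
  exact: (@ccdf_1_cdf _ _ _ psi0 idT y).
exists psi => n; split; apply: tail_le_open_rays => // y;
  rewrite rayE psiE -EFinD lee_fin;
  have := Ff n y; rewrite ler_norml => /andP[? ?]; lra.
Qed.

End Completeness.

(** * The one-step kernel and its contraction *)

(** A kernel sending upper sets to monotone functions of oscillation at most e
    contracts the distance between tails by the factor e. *)
Lemma tail_le_evolve (R : realType) (K e : R) (phi psi : probability R R)
    (k : R.-pker R ~> R) :
  0 <= K -> 0 <= e -> tail_le K phi psi ->
  (forall U, up_closed U ->
     {homo k^~ U : x y / x <= y >-> (x <= y)%E} /\
     exists c : R, forall x, (c%:E <= k x U <= (c + e)%:E)%E) ->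
  tail_le (e * K) (evolve phi k) (evolve psi k).
Proof.
move=> K0 e0 Kpp kU U upU; have mU := up_closed_measurable upU.
have [knd [c ck]] := kU U upU.
have kfin x : k x U \is a fin_num.
  have /andP[cx xc] := ck x.
  rewrite fin_numE gt_eqF ?(lt_le_trans _ cx) ?ltNyr// lt_eqF//.
  by rewrite (le_lt_trans xc) ?ltry.
have evE (chi : probability R R) :
    evolve chi k U = (\int[chi]_x (fine (k x U))%:E)%E.
  by apply: eq_integral => x _; rewrite fineK.
rewrite [leLHS]evE [X in (X + _)%E]evE; apply: (tail_le_integral (c := c)) => //.
- by move=> x y xy; apply: fine_le => //; exact: knd.
- by move=> x; rewrite -!lee_fin fineK.
Qed.

Section ShockKernel.
Context (R : realType) (q : {i01 R}) (mu nu : probability R R).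
Context (h : {mfun R >-> R}).

Lemma measurable_shift (x : R) : measurable_fun [set: R] (fun y : R => x + y).
Proof. exact: measurable_funD. Qed.

Definition shift (x : R) : {mfun R >-> R} :=
  mfun_Sub (mem_set (measurable_shift x)).

(** The transition kernel of the embedded chain: from x, the mixture with
    weights q and 1 - q of mu translated by x (an income shock) and of nu
    translated by h x (a reset). *)
Definition shock_kernel (x : R) : {measure set R -> \bar R} :=
  measure_add (mscale q%:num%:nng (distribution mu (shift x)))
    (mscale (1 - q%:num)%:nng (distribution nu (shift (h x)))).

Lemma shock_kernelE x B : shock_kernel x B =
  ((q%:num)%:E * mu [set y | B (x + y)%R] +
   (1 - q%:num)%:E * nu [set z | B (h x + z)%R])%E.
Proof. exact: measure_addE. Qed.

Lemma measurable_shift_mass (alpha : probability R R) (f : R -> R) B :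
  measurable_fun setT f -> measurable B ->
  measurable_fun setT (fun x => alpha [set y | B (f x + y)]).
Proof.
move=> mf mB.
have mX : measurable ((fun u : R * R => f u.1 + u.2) @^-1` B).
  rewrite -[X in measurable X]setTI; apply: (_ : measurable_fun _ _) => //.
  apply: measurable_funD; last exact: measurable_snd.
  by apply: measurableT_comp => //; exact: measurable_fst.
apply: eq_measurable_fun (measurable_fun_xsection alpha mX) => x _ /=.
by congr (alpha _); apply/seteqP; split => w; rewrite /xsection/= inE.
Qed.

Lemma measurable_shock_kernel B : measurable B ->
  measurable_fun [set: R] (shock_kernel ^~ B).
Proof.
move=> mB; apply: eq_measurable_fun => [x _|]; first by rewrite shock_kernelE.
apply: emeasurable_funD; apply: emeasurable_funM => //.
- exact: (measurable_shift_mass mu (f := fun x => x)).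
- exact: measurable_shift_mass.
Qed.

HB.instance Definition _ := isKernel.Build _ _ _ _ _
  shock_kernel measurable_shock_kernel.

Lemma shock_kernel_setT x : shock_kernel x [set: R] = 1%E.
Proof.
have massT (alpha : probability R R) (y : R) :
    alpha [set z | [set: R] (y + z)] = 1%E by exact: probability_setT.
by rewrite shock_kernelE !massT !mule1 -EFinD subrKC.
Qed.

HB.instance Definition _ := Kernel_isProbability.Build _ _ _ _ _
  shock_kernel shock_kernel_setT.

(** The income branch can oscillate by its full weight q, the reset branch by at
    most 1 - eps times its weight 1 - q; and q + (1 - q) (1 - eps) is the
    factor 1 - (1 - q) eps. *)
Lemma tail_le_shock_kernel (m M eps K : R) (phi psi : probability R R) :
  nondecreasing_fun h -> (forall x, m <= h x <= M) -> eps <= 1 ->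
  (forall U, up_closed U ->
     (nu [set z | U (M + z)%R] <= nu [set z | U (m + z)%R] + (1 - eps)%:E)%E) ->
  0 <= K -> tail_le K phi psi ->
  tail_le ((1 - (1 - q%:num) * eps) * K)
    (evolve phi shock_kernel) (evolve psi shock_kernel).
Proof.
move=> hnd hb eps1 nuM K0 Kpp.
have q0 : 0 <= q%:num by [].
have q1 : 0 <= 1 - q%:num by rewrite subr_ge0.
have mS U x : up_closed U -> measurable [set y : R | U (x + y)].
  by move=> upU; apply: up_closed_measurable; exact: up_closed_shift.
have mono (alpha : probability R R) U x y : up_closed U -> x <= y ->
    (alpha [set z | U (x + z)%R] <= alpha [set z | U (y + z)%R])%E.
  move=> upU xy; apply: le_measure; rewrite ?inE.
  - exact: mS.
  - exact: mS.
  - by move=> z /=; apply: upU; rewrite lerD2r.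
apply: tail_le_evolve => //; first by nra.
move=> U upU; split.
  move=> x y xy; rewrite !shock_kernelE; apply: leeD; apply: lee_pmul => //.
  - exact: mono.
  - by apply: mono => //; exact: hnd.
(* The least value of the reset branch, reached if h takes its lower bound. *)
pose c := nu [set z | U (m + z)].
have cfin : c \is a fin_num.
  by apply: fin_num_measure; exact: mS.
have c0 : (0 <= c)%E by exact: measure_ge0.
exists (fine ((1 - q%:num)%:E * c)) => x.
rewrite (EFinD (fine _)) fineK ?fin_numM// shock_kernelE; apply/andP; split.
  rewrite -[leLHS]add0e; apply: leeD; first exact: mule_ge0.
  by apply: lee_pmul => //; apply: mono => //; case/andP: (hb x).
rewrite (_ : 1 - _ = q%:num * 1 + (1 - q%:num) * (1 - eps)); last by ring.
rewrite (EFinD (_ * 1)) addeCA; apply: leeD.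
  rewrite EFinM; apply: lee_pmul => //.
  apply: probability_le1.
  exact: mS.
rewrite EFinM -muleDr//; last by rewrite fin_num_adde_defl.
apply: lee_pmul => //; apply: le_trans (nuM U upU).
by apply: mono => //; case/andP: (hb x).
Qed.

End ShockKernel.

(** The set of the z with M + z in U but m + z not in U is an interval of length
    M - m, too short to meet both a small ball around a and one around b; eps is
    the smaller of the masses of these two balls. *)
Lemma support_overlap (R : realType) (nu : probability R R) (m M a b : R) :
  measure_support nu a -> measure_support nu b -> M - m < b - a ->
  exists eps : R, [/\ 0 < eps, eps <= 1 & forall U, up_closed U ->
    (nu [set z | U (M + z)%R] <= nu [set z | U (m + z)%R] + (1 - eps)%:E)%E].
Proof.
move=> na nb gap.
(* Half of the excess of b - a over M - m is left on each side. *)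
pose r := (b - a - (M - m)) / 2.
have r0 : 0 < r by rewrite divr_gt0// subr_gt0.
have mball x : measurable (ball x r : set R) by exact: measurable_ball.
have pos x : measure_support nu x -> 0 < fine (nu (ball x r)).
  move=> /(_ (ball x r)) nx; apply: fine_gt0; rewrite nx/=.
    by apply: le_lt_trans (probability_le1 nu (mball x)) _; rewrite ltry.
  by split; [exact: ball_open|exact: ballxx].
have le1 x : fine (nu (ball x r)) <= 1.
  by rewrite -lee_fin fineK ?fin_num_measure//; exact: probability_le1.
pose eps := Num.min (fine (nu (ball a r))) (fine (nu (ball b r))).
exists eps; split; first by rewrite lt_min !pos.
  by rewrite ge_min le1.
move=> U upU.
have upS x : measurable [set z | U (x + z)].
  by apply: up_closed_measurable; exact: up_closed_shift.
pose S := [set z | U (M + z)] `\` [set z | U (m + z)].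
have mS : measurable S by exact: measurableD.
have nuS : (nu S <= (1 - eps)%:E)%E.
  suff miss x : S `&` ball x r = set0 ->
      (nu S <= (1 - fine (nu (ball x r)))%:E)%E.
   have [[z1 [Sz1 bz1]]|/set0P/negP/negPn/eqP Sa] :=
        pselect (S `&` ball a r !=set0); last first.
      by apply: le_trans (miss _ Sa) _; rewrite lee_fin lerD2l lerN2 ge_min lexx.
    suff Sb : S `&` ball b r = set0.
      apply: le_trans (miss _ Sb) _.
      by rewrite lee_fin lerD2l lerN2 ge_min lexx orbT.
    (* From z1 near a with M + z1 in U and z2 near b, the choice of r gives
       M + z1 < m + z2, so that m + z2 is in U as well. *)
    apply/seteqP; split => // z2 [[_ nUz2] bz2]; apply: nUz2.
    case: Sz1 => Uz1 _; apply: upU Uz1.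
    move: bz1 bz2; rewrite /ball/= !ltr_distlC /r => /andP[_ ?] /andP[? _].
    lra.
  move=> Sx; rewrite EFinB fineK ?fin_num_measure//.
  rewrite leeBrDr ?fin_num_measure// -measureU//.
  by apply: probability_le1; exact: measurableU.
apply: le_trans (leeD2l _ nuS).
apply: le_trans (measureU2 _ _ _) => //.
apply: le_measure; rewrite ?inE//; first exact: measurableU.
by move=> z Uz; have [?|?] := pselect (U (m + z)); [left|right].
Qed.

(** * Invariant laws of contracting kernels *)

Definition evolve_iter (R : realType) (k : R.-pker R ~> R)
    (phi : probability R R) (n : nat) : probability R R :=
  iter n (fun psi => evolve psi k : probability R R) phi.

Section InvariantLaw.
Context (R : realType) (k : R.-pker R ~> R) (rho : R).
Hypothesis rho01 : 0 <= rho < 1.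
Hypothesis contraction : forall (K : R) (phi psi : probability R R),
  0 <= K -> tail_le K phi psi ->
  tail_le (rho * K) (evolve phi k) (evolve psi k).

Lemma evolve_iter_tail_le n phi psi :
  tail_le (rho ^+ n) (evolve_iter k phi n) (evolve_iter k psi n).
Proof.
elim: n => [|n IH]; first exact: tail_le1.
by rewrite exprS; apply: contraction => //; rewrite exprn_ge0//; case/andP: rho01.
Qed.

Let cvg_expr_rho : rho ^+ n @[n --> \oo] --> 0.
Proof. by apply: cvg_expr; case/andP: rho01 => ? ?; rewrite ger0_norm. Qed.

(** Banach's fixed point theorem for phi |-> evolve phi k.  Invariance under all
    the iterates is recorded because equality of laws on Borel sets is not
    equality of the measures as functions. *)
Lemma invariant_law_exists :
  exists phi : probability R R, forall n B, measurable B ->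
    evolve_iter k phi n B = phi B.
Proof.
have /andP[rho0 rho1] := rho01.
pose phi0 : probability R R := \d_(0 : R).
pose phi_ n := evolve_iter k phi0 n.
have [//|||psi psiP] := @tail_le_complete R (fun n => rho ^+ n) phi_.
- by move=> n; exact: exprn_ge0.
- exact: cvg_expr_rho.
- move=> n m nm.
  have -> : phi_ m = evolve_iter k (phi_ (m - n)%N) n.
    by rewrite /phi_ /evolve_iter -iterD subnKC.
  by split; exact: evolve_iter_tail_le.
have stepE B : measurable B -> evolve psi k B = psi B.
  apply: (@tail_le_cvg0_eq R (fun n => rho ^+ n.+1 + rho ^+ n.+1)).
    rewrite -[X in _ --> X](addr0 0).
    have rS : rho ^+ n.+1 @[n --> \oo] --> 0.
      by rewrite (cvg_shiftS (fun n => rho ^+ n)); exact: cvg_expr_rho.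
    exact: cvgD.
  move=> n; have [p1 p2] := psiP n.+1; have [p3 p4] := psiP n.
  have rn0 : 0 <= rho ^+ n by exact: exprn_ge0.
  split; apply: (@tail_le_trans _ _ _ (phi_ n.+1)) => //.
    by rewrite exprS; exact: contraction p4.
  by rewrite exprS; exact: contraction p3.
exists psi; elim => [//|n IH] B mB.
rewrite -stepE//; apply: eq_measure_integral => A mA _; exact: IH.
Qed.

End InvariantLaw.

(** * The law of the process *)

(** The law of f X + Y on an event G of mass c, when X, Y and G are independent:
    the restriction of m to G, pushed forward by (X, Y), is a product measure
    because it is one on rectangles, and c is absorbed in its second factor. *)
Lemma sum_law d (T : measurableType d) (R : realType)
    (m : {measure set T -> \bar R}) (X Y : T -> R) (G : set T) (f : R -> R)
    (alpha beta : probability R R) (c : {nonneg R}) :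
  measurable_fun setT X -> measurable_fun setT Y -> measurable G ->
  measurable_fun setT f ->
  (forall A D, measurable A -> measurable D ->
     m [set t | A (X t) /\ D (Y t) /\ G t] = (alpha A * (c%:num%:E * beta D))%E) ->
  forall B, measurable B ->
    m [set t | B (f (X t) + Y t) /\ G t] =
    (c%:num%:E * \int[alpha]_x beta [set y | B (f x + y)%R])%E.
Proof.
move=> mX mY mG mf XY B mB.
have mfB : measurable ((fun u : R * R => f u.1 + u.2) @^-1` B).
  rewrite -[X in measurable X]setTI; apply: (_ : measurable_fun _ _) => //.
  apply: measurable_funD; last exact: measurable_snd.
  by apply: measurableT_comp => //; exact: measurable_fst.
transitivity (pushforward (mrestr m mG) (fun t => (X t, Y t))
    ((fun u : R * R => f u.1 + u.2) @^-1` B)); first by [].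
transitivity ((alpha \x mscale c beta)%E ((fun u : R * R => f u.1 + u.2) @^-1` B)).
  apply/esym; apply: product_measure_unique => //.
    exact: measurable_fun_pair.
  move=> ? A D mA mD; transitivity (alpha A * (c%:num%:E * beta D))%E => //.
  rewrite -XY//.
  by congr (m _); apply/seteqP; split => t; rewrite /preimage /=; tauto.
rewrite /product_measure1 -ge0_integralZl//; last first.
  exact: measurable_shift_mass.
apply: eq_integral => x _ /=; rewrite /mscale/=; congr (_ * beta _)%E.
by apply/seteqP; split => y; rewrite /xsection/= inE.
Qed.

Lemma sigma_of_family_bigcap d (W : measurableType d) (R : realType)
    (P : probability W R) d' (T : measurableType d') (X : nat -> {RV P >-> T})
    (J : seq nat) (B : nat -> set T) :
  (forall i, measurable (B i)) ->
  sigma_of_family setT X (\bigcap_(i in [set` J]) (X i @^-1` B i)).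
Proof.
move=> mB.
pose G := \bigcup_(i in setT) sigma_of (X i).
suff : @measurable _ (g_sigma_algebraType G)
  (\bigcap_(i in [set` J]) (X i @^-1` B i)) by [].
apply: fin_bigcap_measurable; first exact: finite_seq.
move=> i _; apply: sub_sigma_algebra; exists i => //; exists (B i) => //.
by rewrite setTI.
Qed.

Lemma iid_bigcap d (W : measurableType d) (R : realType)
    (P : probability W R) d' (T : measurableType d') (X : nat -> {RV P >-> T})
    (alpha : probability T R) (J : seq nat) (B : nat -> set T) :
  iid X alpha -> uniq J -> (forall i, measurable (B i)) ->
  P (\bigcap_(i in [set` J]) (X i @^-1` B i)) = (\prod_(i <- J) alpha (B i))%E.
Proof.
move=> [indep law] uJ mB; rewrite indep//.
  by apply: eq_bigr => i _; rewrite -(law i).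
by move=> i _; exists (B i) => //; rewrite setTI.
Qed.

Section ProcessLaw.
Context d (W : measurableType d) (R : realType) (P : probability W R).
Context (q : {i01 R}) (mu nu : probability R R) (h : {mfun R >-> R}).
Context (h_nd : nondecreasing_fun h).
Context (N : R -> {RV P >-> nat}) (shock : nat -> {RV P >-> bool}).
Context (eta zeta : nat -> {RV P >-> R}).
Hypothesis iid_shock : iid shock (bernoulli_prob q%:num).
Hypothesis iid_eta : iid eta mu.
Hypothesis iid_zeta : iid zeta nu.
Hypothesis indep : mutually_independent P (fun i : 'I_4 => nth set0
    [:: sigma_of_family [set t | 0 <= t] N; sigma_of_family setT shock;
        sigma_of_family setT eta; sigma_of_family setT zeta] i).

Let Q : R.-pker R ~> R := shock_kernel q mu nu h.

Let chain (n : nat) (u : R * W) : R :=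
  embedded_chain h shock eta zeta (cst u.1) n u.2.

Definition cylinder (C : set W) (J : seq nat) (S : nat -> set bool)
    (E Z : nat -> set R) : set W :=
  C `&` (\bigcap_(i in [set` J]) (shock i @^-1` S i) `&`
   (\bigcap_(i in [set` J]) (eta i @^-1` E i) `&`
    \bigcap_(i in [set` J]) (zeta i @^-1` Z i))).

Lemma cylinder_prob C J S E Z : sigma_of_family [set t | 0 <= t] N C -> uniq J ->
  (forall i, measurable (E i)) -> (forall i, measurable (Z i)) ->
  P (cylinder C J S E Z) =
  (P C * (\prod_(i <- J) bernoulli_prob q%:num (S i) *
    (\prod_(i <- J) mu (E i) * \prod_(i <- J) nu (Z i))))%E.
Proof.
move=> NC uJ mE mZ.
pose A (i : 'I_4) := nth set0 [:: C;
   \bigcap_(i in [set` J]) (shock i @^-1` S i);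
   \bigcap_(i in [set` J]) (eta i @^-1` E i);
   \bigcap_(i in [set` J]) (zeta i @^-1` Z i)] i.
have := indep (J := enum 'I_4) (A := A) (enum_uniq _).
rewrite bigcap_seq !big_enum/= !big_ord_recl !big_ord0 setIT mule1 /A/=.
rewrite (iid_bigcap iid_shock)// (iid_bigcap iid_eta)// (iid_bigcap iid_zeta)//.
apply; case; case=> [|[|[|[|//]]]] /= _ _ => //; exact: sigma_of_family_bigcap.
Qed.

(** The events that the shocks number n and later can decide jointly with the
    clock event C.  Taking them as explicit cylinders, with the sets attached to
    the indices in J, makes their probabilities computable. *)
Definition future (C : set W) (n : nat) (F : set W) : Prop :=
  exists J S E Z, [/\ uniq J, (forall i, i \in J -> (n <= i)%N),
    (forall i, measurable (E i)), (forall i, measurable (Z i)) &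
    F = cylinder C J S E Z].

(** An event decided by the clock and the shocks from number n.+1 on does not
    constrain the shocks number n, so these may be prescribed independently of
    it; the result is again a cylinder, with n added to its indices. *)
Lemma future_cons C n F b D1 D2 : sigma_of_family [set t | 0 <= t] N C ->
  future C n.+1 F -> measurable D1 -> measurable D2 ->
  let F' := F `&` [set w | shock n w = b /\ D1 (eta n w) /\ D2 (zeta n w)] in
  future C n F' /\
  P F' = (P F * ((bernoulli_pmf q%:num b)%:E * (mu D1 * nu D2)))%E.
Proof.
move=> NC [J [S [E [Z [uJ nJ mE mZ ->]]]]] mD1 mD2 F'.
have nJn : n \notin J by apply/negP => /nJ; rewrite ltnn.
(* Overwrites at n; the cylinder over J does not see it, as n is not in J. *)
pose upd T (x : T) (s : nat -> T) i := if i == n then x else s i.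
have F'E : F' = cylinder C (n :: J) (upd _ [set b] S) (upd _ D1 E) (upd _ D2 Z).
  rewrite /F' /cylinder !bigcap_seq !big_cons /upd eqxx.
  have J' T' (V : nat -> W -> T') (x : set T') (s : nat -> set T') :
     \big[setI/setT]_(j <- J) (V j @^-1` (if j == n then x else s j)) =
     \big[setI/setT]_(j <- J) (V j @^-1` s j).
    apply: eq_big_seq => j jJ; case: eqP => // jn.
    by move: nJn; rewrite -jn jJ.
  rewrite !J'//.
  by apply/seteqP; split => w /=; rewrite /preimage/=; tauto.
have mE' i : measurable (upd _ D1 E i) by rewrite /upd; case: ifP.
have mZ' i : measurable (upd _ D2 Z i) by rewrite /upd; case: ifP.
split.
  exists (n :: J), (upd _ [set b] S), (upd _ D1 E), (upd _ D2 Z); split => //.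
    by rewrite /= nJn.
  by move=> i; rewrite inE => /predU1P[->//|/nJ/ltnW].
rewrite F'E !cylinder_prob//=; last by rewrite nJn.
have J' T (x : set T) (s : nat -> set T) (a : set T -> \bar R) :
     (\prod_(j <- J) a (upd _ x s j) = \prod_(j <- J) a (s j))%E.
  apply: eq_big_seq => j jJ; rewrite /upd; case: eqP => // jn.
  by move: nJn; rewrite -jn jJ.
rewrite !big_cons !J' /upd eqxx.
have -> : bernoulli_prob q%:num [set b] = (bernoulli_pmf q%:num b)%:E.
  by rewrite /bernoulli_prob ifT ?fsbig_set1//; apply/andP; split.
rewrite -[RHS]muleA; congr (_ * _)%E.
rewrite [X in (_ * X = _)%E]muleACA [LHS]muleACA; exact: muleC.
Qed.

Lemma cylinder_measurable C J S E Z : measurable C ->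
  (forall i, measurable (E i)) -> (forall i, measurable (Z i)) ->
  measurable (cylinder C J S E Z).
Proof.
move=> mC mE mZ.
have mX d' (T : measurableType d') (X : nat -> {RV P >-> T}) (B : nat -> set T) :
    (forall i, measurable (B i)) ->
    measurable (\bigcap_(i in [set` J]) (X i @^-1` B i)).
  move=> mB; apply: fin_bigcap_measurable; first exact: finite_seq.
  by move=> i _; exact: measurable_funPTI.
by do !apply: measurableI => //; exact: mX.
Qed.

(** The state after n steps is independent of the future.  The statement lives on
    the product space R * W, where the initial state is the first coordinate:
    it then gives the law of the chain from a random initial state without any
    disintegration.  In the induction step, future_cons moves the shocks number
    n from the future into the state; this is why the future has to be carried
    along. *)
Lemma chain_law C (phi : probability R R) n F B : measurable C ->
  sigma_of_family [set t | 0 <= t] N C -> future C n F -> measurable B ->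
  (phi \x P)%E [set u | B (chain n u) /\ F u.2] = (evolve_iter Q phi n B * P F)%E.
Proof.
move=> mC NC; elim: n F B => [|n IH] F B futF mB.
  have mF : measurable F.
    by have [J [S [E [Z [_ _ mE mZ ->]]]]] := futF; exact: cylinder_measurable.
  by rewrite -product_measure1E.
pose Fb b := F `&` shock n @^-1` [set b].
have mF : measurable F.
  by have [J [S [E [Z [_ _ mE mZ ->]]]]] := futF; exact: cylinder_measurable.
have mFb b : measurable (Fb b).
  by apply: measurableI => //; exact: measurable_funPTI.
have mc : measurable_fun setT (chain n) by exact: (measurable_chain h_nd).
have mshift (X : {RV P >-> R}) : measurable_fun setT (fun u : R * W => X u.2).
  by apply: measurableT_comp => //; exact: measurable_snd.
have m2 G : measurable G -> measurable [set u : R * W | G u.2].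
  by move=> mG; rewrite -[X in measurable X]setTI; exact: measurable_snd.
have pmf_ge0 b : 0 <= bernoulli_pmf q%:num b.
  by apply: bernoulli_pmf_ge0; apply/andP; split.
have PFge0 b : 0 <= fine (P F) * bernoulli_pmf q%:num b.
  by apply: mulr_ge0 => //; exact/fine_ge0/measure_ge0.
have PFE : P F = (fine (P F))%:E by rewrite fineK// fin_num_measure.
(* The contribution of one branch, f being the identity or h. *)
have partE b (X : {RV P >-> R}) (al : probability R R) (f : R -> R) :
    measurable_fun setT f ->
    (forall D, measurable D -> future C n (Fb b `&` X @^-1` D) /\
       P (Fb b `&` X @^-1` D) = (P F * ((bernoulli_pmf q%:num b)%:E * al D))%E) ->
    (phi \x P)%E [set u | B (f (chain n u) + X u.2) /\ Fb b u.2] =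
    (P F * ((bernoulli_pmf q%:num b)%:E *
      \int[evolve_iter Q phi n]_x al [set y | B (f x + y)%R]))%E.
  move=> mf FX.
  have -> := @sum_law _ _ _ (phi \x P)%E (chain n) (fun u => X u.2)
    [set u | Fb b u.2] f (evolve_iter Q phi n) al (NngNum (PFge0 b)).
  - by rewrite /= EFinM -PFE muleA.
  - exact: mc.
  - exact: mshift.
  - exact: m2.
  - exact: mf.
  - move=> A D mA mD; have [futX PX] := FX D mD.
    rewrite [RHS](_ : _ = (evolve_iter Q phi n A * P (Fb b `&` X @^-1` D))%E).
      rewrite -IH//; congr (product_measure1 _ _ _).
      by apply/seteqP; split => u; rewrite /preimage/=; tauto.
    by rewrite PX/= EFinM -PFE -!muleA.
  - exact: mB.
have -> : [set u | B (chain n.+1 u) /\ F u.2] =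
    [set u | B (chain n u + eta n u.2) /\ Fb true u.2] `|`
    [set u | B (h (chain n u) + zeta n u.2) /\ Fb false u.2].
  apply/seteqP; split => u /=; rewrite /chain/= /Fb/= /preimage/=.
    by case: (shock n u.2) => -[? ?]; [left|right].
  by case=> -[Bu [Fu ->]].
have mpart (f : R -> R) (X : {RV P >-> R}) b : measurable_fun setT f ->
    measurable [set u | B (f (chain n u) + X u.2) /\ Fb b u.2].
  move=> mf; apply: measurableI; last exact: m2.
  rewrite -[X in measurable X]setTI; apply: (_ : measurable_fun _ _) => //.
  apply: measurable_funD; last exact: mshift.
  exact: (measurableT_comp mf mc).
rewrite measureU; last 3 first.
- by apply: (mpart (fun x => x)); exact: measurable_id.
- exact: mpart.
- apply/seteqP; split => // u /=; rewrite /Fb/= /preimage/=.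
  by move=> [[_ [_ ->]] [_ [_]]].
have /= partT := partE true (eta n) mu id.
rewrite partT//; last first.
  move=> D mD; have [] := future_cons true NC futF mD measurableT.
  rewrite probability_setT mule1.
  rewrite (_ : _ `&` _ = Fb true `&` eta n @^-1` D)//.
  by apply/seteqP; split => w; rewrite /Fb/preimage/=; tauto.
rewrite (partE false (zeta n) nu h)//; last first.
  move=> D mD; have [] := future_cons false NC futF measurableT mD.
  rewrite probability_setT mul1e.
  rewrite (_ : _ `&` _ = Fb false `&` zeta n @^-1` D)//.
  by apply/seteqP; split => w; rewrite /Fb/preimage/=; tauto.
rewrite -muleDr; last 2 first.
- by rewrite PFE.
- apply: ge0_adde_def; rewrite inE; apply: mule_ge0; rewrite ?lee_fin ?pmf_ge0//.
  + exact: integral_ge0.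
  + exact: integral_ge0.
rewrite muleC; congr (_ * _)%E.
have mmu : measurable_fun setT (fun x : R => mu [set y | B (x + y)%R]).
  exact: (measurable_shift_mass mu (f := fun x => x)).
have mnu : measurable_fun setT (fun x : R => nu [set y | B (h x + y)%R]).
  exact: measurable_shift_mass.
rewrite -!ge0_integralZl//; first last.
- by rewrite lee_fin pmf_ge0.
rewrite -ge0_integralD//; first last.
- exact: emeasurable_funM.
- by move=> x _; apply: mule_ge0; rewrite ?lee_fin ?pmf_ge0.
- exact: emeasurable_funM.
- by move=> x _; apply: mule_ge0; rewrite ?lee_fin.
by apply: eq_integral => x _; rewrite shock_kernelE.
Qed.

(** Conditioning on the number of jumps up to time t. *)
Lemma evolve_transition (phi : probability R R) t B : 0 <= t -> measurable B ->
  evolve phi (transition h_nd N shock eta zeta t) B =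
  (\sum_(0 <= n <oo) (P (N t @^-1` [set n]) * evolve_iter Q phi n B))%E.
Proof.
move=> t0 mB.
pose E n := [set u : R * W | B (chain n u) /\ (N t @^-1` [set n]) u.2].
have mN n : measurable (N t @^-1` [set n]) by exact: measurable_funPTI.
have mE n : measurable (E n).
  apply: measurableI; rewrite -[X in measurable X]setTI.
    exact: (measurable_chain h_nd).
  exact: measurable_snd.
transitivity ((phi \x P)%E (\bigcup_n E n)).
  rewrite [LHS]/evolve /product_measure1; apply: eq_integral => x _ /=.
  rewrite /pushforward /=; congr (P _); apply/seteqP; split => w;
    rewrite /xsection/= inE /E/chain/log_income/=.
    by move=> Bw; exists (N t w).
  by move=> [n _ [Bw Nn]]; rewrite (Nn : N t w = n).
rewrite measure_semi_bigcup//; last 2 first.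
- apply/trivIsetP => i j _ _ ij; apply/seteqP; split => // u [[_ Ni] [_ Nj]].
  by move/eqP: ij; apply; rewrite -Ni -Nj.
- exact: bigcup_measurable.
apply: eq_eseriesr => n _; rewrite muleC -(chain_law (C := N t @^-1` [set n]))//.
- apply: sub_sigma_algebra; exists t => //.
  by exists [set n] => //; rewrite setTI.
- exists [::], (fun=> setT), (fun=> setT), (fun=> setT); split => //.
  by rewrite /cylinder !bigcap_seq !big_nil !setIT.
Qed.

End ProcessLaw.

(** * The Poisson clock *)

Section PoissonClock.
Context d (W : measurableType d) (R : realType) (P : probability W R).

Lemma ae_eq_measure (A B : set W) : measurable A -> measurable B ->
  {ae P, forall w, A w <-> B w} -> P A = P B.
Proof.
move=> mA mB [Z [mZ Z0 ABZ]].
have le (C D : set W) : measurable C -> measurable D ->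
    (forall w, ~ Z w -> C w -> D w) -> (P C <= P D)%E.
  move=> mC mD CD; rewrite -(measureU0 mD mZ Z0); apply: le_measure.
  - by rewrite inE.
  - by rewrite inE; exact: measurableU.
  - by move=> w Cw; have [Zw|nZw] := pselect (Z w); [right|left; exact: CD].
have AB w : ~ Z w -> (A w <-> B w).
  by move=> nZw; apply: contrapT => nAB; apply: nZw; exact: ABZ.
by apply/eqP; rewrite eq_le !le// => w /AB[].
Qed.

(** The process starts at 0 only almost surely, hence N t and its increment over
    [0, t] agree up to a null set. *)
Lemma poisson_process_law (lambda : R) (N : R -> {RV P >-> nat}) t n :
  poisson_process lambda N -> 0 < t ->
  P (N t @^-1` [set n]) = (poisson_pmf (lambda * t) n)%:E.
Proof.
move=> [paths incr _] t0; rewrite -[in RHS](subr0 t) -incr//.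
apply: ae_eq_measure.
- exact: measurable_funPTI.
- rewrite (_ : [set w | _] = \bigcup_k ((N 0 @^-1` [set k]) `&`
      (N t @^-1` [set m | (m - k)%N = n]))).
    by apply: bigcup_measurable => k _; apply: measurableI; exact: measurable_funPTI.
  apply/seteqP; split => w /=; first by exists (N 0 w).
  by move=> [k _ [/= <-]].
- by apply: filterS paths => w [N0 _ _]; rewrite /preimage/= N0 subn0.
Qed.

Lemma sum_prob_nat (X : {RV P >-> nat}) :
  (\sum_(0 <= n <oo) P (X @^-1` [set n]) = 1)%E.
Proof.
rewrite -(probability_setT P) (_ : setT = \bigcup_n (X @^-1` [set n])); last first.
  by apply/seteqP; split => // w _; exists (X w).
rewrite measure_semi_bigcup//.
- by move=> n; exact: measurable_funPTI.
- apply/trivIsetP => i j _ _ ij; apply/seteqP; split => // w [/= Xi Xj].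
  by move/eqP: ij; apply; rewrite -Xi -Xj.
- by apply: bigcup_measurable => n _; exact: measurable_funPTI.
Qed.

Lemma sum_poisson_pmf (a : R) : 0 < a ->
  (\sum_(0 <= n <oo) (poisson_pmf a n)%:E = 1)%E.
Proof.
move=> a0; rewrite -(probability_setT (poisson_prob a 0)).
rewrite [RHS]/= /poisson_prob a0 nneseries_esumT// => n.
by rewrite lee_fin poisson_pmf_ge0.
Qed.

(** The generating function of the Poisson law of mean a: tilting it by s^n gives
    the Poisson law of mean a s, up to the factor exp (- a (1 - s)). *)
Lemma sum_poisson_pmf_expr (a s : R) : 0 < a -> 0 < s ->
  (\sum_(0 <= n <oo) ((poisson_pmf a n)%:E * (s ^+ n)%:E) =
   (expR (- (a * (1 - s))))%:E)%E.
Proof.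
move=> a0 s0; have as0 : 0 < a * s by rewrite mulr_gt0.
rewrite -[RHS]mule1 -(sum_poisson_pmf as0) -nneseriesZl; last first.
  by move=> n _; rewrite lee_fin poisson_pmf_ge0.
apply: eq_eseriesr => n _; rewrite -!EFinM; congr EFin.
rewrite /poisson_pmf a0 as0 exprMn.
rewrite (_ : - a = - (a * (1 - s)) + - (a * s)); last by ring.
by rewrite expRD; ring.
Qed.

End PoissonClock.

(** * Global stability *)

(** After n jumps any two laws are within rho^n of each other; averaging over the
    Poisson number of jumps up to time t gives an exponential rate. *)
Lemma tail_le_transition (R : realType) d (W : measurableType d)
    (P : probability W R) (q : {i01 R}) (mu nu : probability R R)
    (h : {mfun R >-> R}) (h_nd : nondecreasing_fun h) (lambda rho t : R)
    (N : R -> {RV P >-> nat}) (shock : nat -> {RV P >-> bool})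
    (eta zeta : nat -> {RV P >-> R}) :
  poisson_process lambda N -> iid shock (bernoulli_prob q%:num) ->
  iid eta mu -> iid zeta nu ->
  mutually_independent P (fun i : 'I_4 => nth set0
    [:: sigma_of_family [set t | 0 <= t] N; sigma_of_family setT shock;
        sigma_of_family setT eta; sigma_of_family setT zeta] i) ->
  (forall (K : R) (phi psi : probability R R), 0 <= K -> tail_le K phi psi ->
   tail_le (rho * K) (evolve phi (shock_kernel q mu nu h))
    (evolve psi (shock_kernel q mu nu h))) ->
  0 < rho < 1 -> 0 < lambda -> 0 < t ->
  forall phi psi : probability R R,
  tail_le (expR (- (lambda * (1 - rho) * t)))
    (evolve phi (transition h_nd N shock eta zeta t))
    (evolve psi (transition h_nd N shock eta zeta t)).
Proof.
move=> clock iidS iidE iidZ indep contr /andP[rho0 rho1] lambda0 t0 phi psi U upU.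
have mU := up_closed_measurable upU.
have evE (chi : probability R R) :
    (evolve chi (transition h_nd N shock eta zeta t) U =
     \sum_(0 <= n <oo) ((poisson_pmf (lambda * t) n)%:E *
       evolve_iter (shock_kernel q mu nu h) chi n U))%E.
  rewrite (evolve_transition h_nd iidS iidE iidZ indep) ?(ltW t0)//.
  by apply: eq_eseriesr => n _; rewrite (poisson_process_law n clock t0).
rewrite [leLHS]evE [X in (X + _)%E]evE.
rewrite (_ : lambda * (1 - rho) * t = lambda * t * (1 - rho)); last by ring.
rewrite -sum_poisson_pmf_expr// ?mulr_gt0//.
have pmf0 n : (0 <= (poisson_pmf (lambda * t) n)%:E)%E.
  by rewrite lee_fin poisson_pmf_ge0.
have rhon0 n : 0 <= rho ^+ n by rewrite exprn_ge0// ltW.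
rewrite -nneseriesD; last 2 first.
- by move=> n _ _; rewrite mule_ge0.
- by move=> n _ _; rewrite mule_ge0// lee_fin.
apply: lee_nneseries => [n _ _|n _]; first by rewrite mule_ge0.
rewrite -ge0_muleDr ?lee_fin//; apply: lee_pmul => //.
by apply: evolve_iter_tail_le => //; rewrite (ltW rho0).
Qed.

Theorem proposition7p1 (R : realType) (d : measure_display)
    (W : measurableType d) (P : probability W R)
    (lambda1 lambda2 : R) (mu nu : probability R R) (h : R -> R)
    (N : R -> {RV P >-> nat}) (shock : nat -> {RV P >-> bool})
    (eta zeta : nat -> {RV P >-> R})
    (lambda1_gt0 : 0 < lambda1) (lambda2_gt0 : 0 < lambda2)
    (mu_pos : mu [set x | 0 < x] = 1%E)
    (h_bounded : [bounded h x | x in [set: R]])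
    (h_nd : nondecreasing_fun h)
    (h_gap : exists a b : R, [/\ measure_support nu a, measure_support nu b &
       sup (range h) - inf (range h) < b - a])
    (driver : log_income_driver lambda1 lambda2 mu nu N shock eta zeta) :
  globally_stable (transition h_nd N shock eta zeta).
Proof.
case: driver => clock iidS iidE iidZ indep.
have lambda_gt0 : 0 < lambda1 + lambda2 by rewrite addr_gt0.
have q_gt0 : 0 < lambda1 / (lambda1 + lambda2) by rewrite divr_gt0.
have q_lt1 : lambda1 / (lambda1 + lambda2) < 1.
  by rewrite ltr_pdivrMr// mul1r ltrDl.
pose q : {i01 R} := Itv01 (ltW q_gt0) (ltW q_lt1).
have mh : measurable_fun setT h by exact: nondecreasing_measurable.
pose hm : {mfun R >-> R} := mfun_Sub (mem_set mh).
have hb x : inf (range h) <= h x <= sup (range h).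
  have [M [_ hM]] := h_bounded.
  have {}hM y : `|h y| <= M + 1 by apply: (hM (M + 1)) => //; rewrite ltrDl.
  apply/andP; split.
    apply: ge_inf; last by exists x.
    exists (- (M + 1)) => _ [y _ <-].
    by have := hM y; rewrite ler_norml => /andP[].
  apply: ub_le_sup; last by exists x.
  exists (M + 1) => _ [y _ <-].
  by have := hM y; rewrite ler_norml => /andP[].
have [a [b [na nb gap]]] := h_gap.
have [eps [eps0 eps1 nuM]] := support_overlap na nb gap.
pose rho := 1 - (1 - q%:num) * eps.
have rho01 : 0 < rho < 1.
  have q0 : 0 < q%:num := q_gt0.
  have q1 : q%:num < 1 := q_lt1.
  rewrite /rho; clear -q0 q1 eps0 eps1.
  by apply/andP; split; nra.
have /andP[rho0 rho1] := rho01.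
have rho01' : 0 <= rho < 1 by rewrite rho1 (ltW rho0).
have contr (K : R) (phi psi : probability R R) : 0 <= K -> tail_le K phi psi ->
    tail_le (rho * K) (evolve phi (shock_kernel q mu nu hm))
      (evolve psi (shock_kernel q mu nu hm)).
  exact: (@tail_le_shock_kernel _ q mu nu hm _ _ _ _ _ _ h_nd hb eps1 nuM).
have [psi0 psi0E] := invariant_law_exists rho01' contr.
have stat : stationary (transition h_nd N shock eta zeta) psi0.
  move=> t t0 B mB.
  rewrite (@evolve_transition _ _ _ _ q mu nu hm h_nd _ _ _ _
    iidS iidE iidZ indep)//.
  rewrite -[RHS]mul1e -(sum_prob_nat (N t)).
  rewrite -[in RHS](fineK (fin_num_measure psi0 _ mB)) muleC -nneseriesZl//.
  by apply: eq_eseriesr => n _; rewrite psi0E// fineK ?fin_num_measure// muleC.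
pose c := (lambda1 + lambda2) * (1 - rho).
have c0 : 0 < c by rewrite mulr_gt0// subr_gt0.
have mixing t (phi psi : probability R R) : 0 < t ->
    tail_le (expR (- (c * t)))
      (evolve phi (transition h_nd N shock eta zeta t))
      (evolve psi (transition h_nd N shock eta zeta t)).
  by move=> t0; apply: (@tail_le_transition _ _ _ _ q mu nu hm).
have expc : expR (- (c * t)) @[t --> +oo] --> 0.
  have ct : c * t @[t --> +oo] --> +oo.
    apply/cvgryPge => A; near=> t.
    by rewrite -ler_pdivrMl//; near: t; exact: nbhs_pinfty_ge.
  exact: (cvg_comp _ _ ct (@cvgr_expR R)).
have stat_tail t (psi chi : probability R R) :
    stationary (transition h_nd N shock eta zeta) psi ->
    stationary (transition h_nd N shock eta zeta) chi ->
    0 < t -> tail_le (expR (- (c * t))) psi chi.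
  move=> spsi schi t0 U upU; have mU := up_closed_measurable upU.
  by rewrite -(spsi t (ltW t0) U mU) -(schi t (ltW t0) U mU); exact: mixing.
exists psi0; split => //.
  move=> psi spsi.
  apply: (@tail_le_cvg0_eq _ (fun n => expR (- (c * n.+1%:R)))).
    apply: (cvg_comp (fun n : nat => n.+1%:R : R)
      (fun t => expR (- (c * t))) _ expc).
    rewrite (cvg_shiftS (fun n => n%:R : R)); exact: cvgr_idn.
  by move=> n; split; apply: stat_tail.
move=> phi.
apply: (squeeze_cvge (f := cst 0%E) (h := fun t => (2 * expR (- (c * t)))%:E)).
- near=> t; apply: beta_dist_le; first exact: expR_ge0.
  + move=> U upU; have mU := up_closed_measurable upU.
    have t0 : 0 < t by near: t; exact: nbhs_pinfty_gt.
    by rewrite -[X in (_ <= X + _)%E](stat t (ltW t0) U mU); exact: mixing.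
  + move=> U upU; have mU := up_closed_measurable upU.
    have t0 : 0 < t by near: t; exact: nbhs_pinfty_gt.
    by rewrite -[leLHS](stat t (ltW t0) U mU); exact: mixing.
- exact: cvg_cst.
- apply: cvg_EFin; first by near=> t.
  rewrite -[X in _ --> X](mulr0 2); apply: cvgM => //; exact: cvg_cst.
Unshelve. all: by end_near. Qed.
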